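(* Let $K$ be an algebraically closed field. The semigroup $[\mathrm{Coll}_\infty(1)]$ (with the $\circ$-multiplication) is commutative.
   Context: Write elements of $\mathrm{Mat}(1+N,K)$ as block matrices $g=\begin{pmatrix} a & b \\ c & d \end{pmatrix}$ with $a$ of size $1\times1$ and $d$ of size $N\times N$. The group $\mathrm{GL}(N,K)$ acts by conjugation by $\begin{pmatrix} 1 & 0 \\ 0 & u \end{pmatrix}$, $u\in \mathrm{GL}(N,K)$. Denote by $[\mathrm{Coll}_N(1)]$ the categorical quotient, i.e. the affine variety (closed points of the spectrum) of the algebra of $\mathrm{GL}(N,K)$-invariant polynomials on $\mathrm{Mat}(1+N,K)$. For $g=\begin{pmatrix} a & b \\ c & d \end{pmatrix}\in\mathrm{Mat}(1+N_1,K)$ and $h=\begin{pmatrix} p & q \\ r & t \end{pmatrix}\in\mathrm{Mat}(1+N_2,K)$ set $g\circ h=\begin{pmatrix} ap & b & aq \\ cp & d & cq \\ r & 0 & t \end{pmatrix}\in \mathrm{Mat}(1+N_1+N_2,K)$. This induces an operation $[\mathrm{Coll}_{N_1}(1)]\times[\mathrm{Coll}_{N_2}(1)]\to[\mathrm{Coll}_{N_1+N_2}(1)]$. The maps $\begin{pmatrix} a & b \\ c & d \end{pmatrix}\mapsto\begin{pmatrix} a & b & 0 \\ c & d & 0 \\ 0 & 0 & 1 \end{pmatrix}$ induce embeddings $[\mathrm{Coll}_N(1)]\to[\mathrm{Coll}_{N+1}(1)]$; $[\mathrm{Coll}_\infty(1)]$ is the inductive limit, with the induced associative $\circ$-multiplication.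 *)

(* Defs.v *)
From HB Require Import structures.
From mathcomp Require Import all_boot all_order all_algebra.
From mathcomp Require Import mpoly.
From mathcomp Require Import boolp.
Set Implicit Arguments. Unset Strict Implicit. Unset Printing Implicit Defensive.
Import GRing.Theory.
Local Open Scope ring_scope.

Section PrimeIdeals.
Variables (R : comNzRingType) (P : {pred R}).
Hypothesis idP : idealr_closed P.

Lemma ideal0 : 0 \in P. Proof. by case: idP. Qed.
Lemma ideal1F : (1 \in P) = false. Proof. by case: idP => _ /negbTE. Qed.
Lemma idealD x y : x \in P -> y \in P -> x + y \in P.
Proof. by move=> Px Py; case: idP => _ _ /(_ 1 x y Px Py); rewrite mul1r. Qed.
Lemma idealM a x : x \in P -> a * x \in P.
Proof. by move=> Px; case: idP => P0 _ /(_ a x 0 Px P0); rewrite addr0. Qed.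
Lemma idealB x y : x \in P -> y \in P -> x - y \in P.
Proof. by move=> Px Py; rewrite -mulN1r; apply/idealD/idealM. Qed.
Lemma ideal_sum (I : Type) (r : seq I) (F : I -> R) :
  (forall i, F i \in P) -> \sum_(i <- r) F i \in P.
Proof.
move=> PF; elim: r => [|i r IH]; rewrite ?big_nil ?ideal0 // big_cons.
exact: idealD.
Qed.

Hypothesis prP : prime_idealr_closed P.

Lemma primeXF x k : x \notin P -> x ^+ k \notin P.
Proof.
move=> Px; elim: k => [|k IH]; first by rewrite expr0 ideal1F.
by apply/negP; rewrite exprS => /prP/orP[]; apply/negP.
Qed.
Lemma primeMF x y : x \notin P -> y \notin P -> x * y \notin P.
Proof. by move=> Px Py; apply/negP => /prP/orP[]; apply/negP. Qed.
End PrimeIdeals.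

(* A point of the contraction of a prime ideal of T[x] avoiding a suitable
   element of T lifts to a point of the prime ideal *)
Section Extension.
Variables (T : idomainType) (K : closedFieldType) (P : {pred {poly T}}).
Hypotheses (idP : idealr_closed P) (prP : prime_idealr_closed P).

Let coefsP (f : {poly T}) : Prop := forall i, (f`_i)%:P \in P.

Let coefsP_in f : coefsP f -> f \in P.
Proof.
move=> fP; rewrite -[f]coefK poly_def; apply: (ideal_sum idP) => i.
by rewrite -mul_polyC mulrC; apply: (idealM idP); apply: fP.
Qed.

Let coefsPM f g : coefsP f -> coefsP (f * g).
Proof.
move=> fP i; rewrite coefM rmorph_sum; apply: (ideal_sum idP) => j.
by rewrite rmorphM mulrC; apply: (idealM idP); apply: fP.
Qed.

Let coefsPD f g : coefsP f -> coefsP g -> coefsP (f + g).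
Proof. by move=> fP gP i; rewrite coefD rmorphD; apply: (idealD idP); [apply: fP | apply: gP]. Qed.

Let coefsP_small (I : {poly T} -> Prop) k :
  (forall f g, I f -> g \in P -> I (f - g)) ->
  (forall f, I f -> (size f < k)%N -> (lead_coef f)%:P \in P) ->
  forall f, I f -> (size f < k)%N -> coefsP f.
Proof.
move=> IB Ilead f.
have [m] := ubnP (size f); elim: m => // m IHm in f *.
rewrite ltnS => fm If fk.
have [->|f0] := eqVneq f 0; first by move=> i; rewrite coef0 (ideal0 idP).
have lP := Ilead f If fk.
set h := lead_coef f *: 'X^((size f).-1).
have hP : coefsP h.
  move=> i; rewrite coefZ coefXn; case: eqP => _; rewrite ?mulr1 //.
  by rewrite mulr0 (ideal0 idP).
have szh : (size (f - h)%R < size f)%N.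
  have f1 : (0 < size f)%N by rewrite size_poly_gt0.
  rewrite -(prednK f1) ltnS; apply/leq_sizeP => j.
  rewrite coefB coefZ coefXn leq_eqVlt => /orP[/eqP <-|jf].
    by rewrite eqxx mulr1 lead_coefE subrr.
  by rewrite gtn_eqF // mulr0 subr0 nth_default // -(prednK f1).
rewrite -[f](subrK h); apply: coefsPD; last exact: hP.
apply: IHm.
- exact: leq_trans szh fm.
- by apply: IB => //; apply: coefsP_in.
- exact: ltn_trans szh fk.
Qed.

Let map_coefsP (phi : {rmorphism T -> K}) f :
  (forall t, t%:P \in P -> phi t = 0) -> coefsP f -> map_poly phi f = 0.
Proof. by move=> kphi fP; apply/polyP => i; rewrite coef_map coef0; apply/kphi/fP. Qed.

Let nonroot (q : {poly K}) : q != 0 -> exists xi, q.[xi] != 0.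
Proof.
move=> q0; have [/size_poly1P[c c0 ->]|sq] := boolP (size q == 1%N).
  by exists 0; rewrite hornerC.
have /closed_rootP[xi /rootP] : size (q - 1) != 1%N.
  have sq1 : (1 < size q)%N by rewrite ltn_neqAle eq_sym sq size_poly_gt0.
  by rewrite size_polyDl // size_polyN size_poly1.
rewrite hornerD hornerN hornerC => /eqP; rewrite subr_eq0 => /eqP qxi.
by exists xi; rewrite qxi oner_eq0.
Qed.

Lemma prime_extension (s : {poly T}) : s \notin P ->
  exists2 r : T, r%:P \notin P & forall phi : {rmorphism T -> K},
    (forall t, t%:P \in P -> phi t = 0) -> phi r != 0 ->
  exists xi, (forall f, f \in P -> (map_poly phi f).[xi] = 0)
             /\ (map_poly phi s).[xi] != 0.
Proof.
move=> sP.
pose bad k := `[< exists f, [/\ f \in P, (lead_coef f)%:P \notin P & size f = k] >].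
have [[k0 badk0]|nobad] := pselect (exists k, bad k); last first.
  have PcP f : f \in P -> coefsP f.
    move=> fP; apply: (@coefsP_small (fun f => f \in P) (size f).+1) => //.
      by move=> g h gP hP; apply: idealB.
    move=> g gP _; apply/negPn/negP => lg; apply: nobad; exists (size g).
    by apply/asboolP; exists g.
  have [r rP [i ri]] : exists2 r, r%:P \notin P & exists i, r = s`_i.
    apply: contrapT => H; move: sP; rewrite coefsP_in // => i.
    by apply/negPn/negP => si; apply: H; exists (s`_i) => //; exists i.
  exists r => // phi kphi phir.
  have [|xi sxi] := @nonroot (map_poly phi s).
    by apply: contraNneq phir => s0; rewrite ri -coef_map s0 coef0.
  exists xi; split=> // f /PcP fP.
  by rewrite (map_coefsP kphi fP) horner0.
have exbad : exists k, bad k by exists k0.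
case: (ex_minnP exbad) => k /asboolP[p [pP lp szp]] mink.
have PcP f : f \in P -> ((size f < k)%N)%N -> coefsP f.
  apply: (@coefsP_small (fun f => f \in P) k).
    by move=> g h gP hP; apply: idealB.
  move=> g gP gk; apply/negPn/negP => lg.
  by move: gk; rewrite ltnNge mink //; apply/asboolP; exists g.
have p0 : p != 0 by apply: contraNneq lp => ->; rewrite lead_coef0 ideal0.
pose I h := exists u w, w \in P /\ h = u * s + w.
have PI f : f \in P -> I f by move=> fP; exists 0, f; rewrite mul0r add0r.
have ID f g : I f -> I g -> I (f + g).
  move=> [u [w [wP ->]]] [u' [w' [w'P ->]]]; exists (u + u'), (w + w').
  by split; [apply: idealD | rewrite mulrDl addrACA].
have IM a f : I f -> I (a * f).
  move=> [u [w [wP ->]]]; exists (a * u), (a * w).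
  by split; [apply: idealM | rewrite mulrDr mulrA].
have IB f g : I f -> I g -> I (f - g).
  by move=> If Ig; rewrite -mulN1r; apply/ID/IM.
have Is : I s by exists 1, 0; rewrite mul1r addr0 ideal0.
have [r' r'P Ir'] : exists2 r', r'%:P \notin P & I r'%:P.
  pose badI j := `[< exists f, [/\ I f, (lead_coef f)%:P \notin P & size f = j] >].
  have exI : exists j, badI j.
    by exists k; apply/asboolP; exists p; split=> //; apply: PI.
  case: (ex_minnP exI) => j /asboolP[g [Ig lg szg]] minj.
  have IcP f : I f -> (size f < j)%N -> coefsP f.
    apply: (@coefsP_small I j) => [f' h If' hP|f' If' f'j].
      by apply: IB => //; apply: PI.
    apply/negPn/negP => lf.
    by move: f'j; rewrite ltnNge minj //; apply/asboolP; exists f'.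
  have g0 : g != 0 by apply: contraNneq lg => ->; rewrite lead_coef0 ideal0.
  have [sg|sg] := leqP (size g) 1.
    exists (lead_coef g) => //.
    have -> : (lead_coef g)%:P = g by rewrite lead_coefE [in RHS](size1_polyC sg);
      rewrite (size1_polyC sg) size_polyC; case: eqP.
    exact: Ig.
  have divg f : I f -> exists2 q, (lead_coef g ^+ Pdiv.Idomain.scalp f g)%:P * f
       = q * g + Pdiv.Idomain.modp f g & q = Pdiv.Idomain.divp f g /\
      coefsP (Pdiv.Idomain.modp f g).
    move=> If; exists (Pdiv.Idomain.divp f g); first by rewrite mul_polyC Pdiv.Idomain.divp_eq.
    split=> //; apply: IcP; last by rewrite -szg Pdiv.Idomain.ltn_modp.
    have -> : Pdiv.Idomain.modp f g = (lead_coef g ^+ Pdiv.Idomain.scalp f g)%:P * f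
       - Pdiv.Idomain.divp f g * g.
      by rewrite mul_polyC Pdiv.Idomain.divp_eq addrAC subrr add0r.
    by apply: IB; apply: IM.
  have [q Eq [dq remP]] := divg p (PI p pP).
  have [q2 Eq2 [_ rem2P]] := divg s Is.
  have gP : g \notin P.
    apply/negP => gP; have : (lead_coef g ^+ Pdiv.Idomain.scalp s g)%:P * s \in P.
      by rewrite Eq2; apply: (idealD idP); [apply: idealM | apply: coefsP_in].
    by apply/negP/primeMF => //; rewrite rmorphXn; apply: primeXF.
  have : q \in P.
    have : q * g \in P.
      rewrite -[q * g](addrK (Pdiv.Idomain.modp p g)) -Eq; apply: (idealB idP).
        exact: idealM.
      exact: coefsP_in.
    by move/prP; rewrite (negbTE gP) orbF.
  move/PcP; rewrite dq size_divp // -dq => /(_ _) qP.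
  have {}qP : coefsP q.
    apply: qP; rewrite -szp ltn_subrL size_poly_gt0 p0 andbT.
    by case: (size g) sg => [|[]].
  have : coefsP ((lead_coef g ^+ Pdiv.Idomain.scalp p g)%:P * p).
    by rewrite Eq; apply: coefsPD => //; apply: coefsPM.
  move/(_ (size p).-1); rewrite coefCM -lead_coefE rmorphM => H; exfalso.
  move: H; apply/negP/primeMF => //.
  by rewrite rmorphXn; apply: primeXF.
exists (lead_coef p * r').
  by rewrite rmorphM; apply: primeMF.
move=> phi kphi; rewrite rmorphM mulf_eq0 negb_or => /andP[phil phir].
have szphi : size (map_poly phi p) = size p by apply: size_map_poly_id0.
have /closed_rootP[xi /rootP pxi] : size (map_poly phi p) != 1%N.
  rewrite szphi; apply: contraNneq lp => sp1.
  by rewrite (size1_polyC (eq_leq sp1)) lead_coefC -size1_polyC // sp1.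
have Pxi f : f \in P -> (map_poly phi f).[xi] = 0.
  move=> fP.
  have /(congr1 (fun h => (map_poly phi h).[xi])) := Pdiv.Idomain.divp_eq f p.
  have remP : coefsP (Pdiv.Idomain.modp f p).
    apply: PcP; last by rewrite -szp ltn_modp.
    rewrite -[Pdiv.Idomain.modp f p](addKr (Pdiv.Idomain.divp f p * p)).
    rewrite -Pdiv.Idomain.divp_eq addrC; apply: (idealB idP).
      by rewrite -mul_polyC; apply: idealM.
    exact: idealM.
  rewrite rmorphD rmorphM /= (map_coefsP kphi remP) addr0 map_polyZ /=.
  rewrite hornerM pxi mulr0 hornerZ rmorphXn => /eqP.
  by rewrite mulf_eq0 expf_eq0 (negbTE phil) andbF => /eqP.
exists xi; split=> //.
have [u [w [wP Er]]] := Ir'.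
apply: contraNneq phir => sxi.
have := congr1 (fun h => (map_poly phi h).[xi]) Er.
rewrite map_polyC hornerC /= => ->.
by rewrite rmorphD rmorphM /= hornerD hornerM sxi mulr0 add0r Pxi.
Qed.
End Extension.

Section Nullstellensatz.
Variable K : closedFieldType.
Local Notation widen := (widen_ord (leqnSn _)).

Let E n (p : {poly {mpoly K[n]}}) : {mpoly K[n.+1]} :=
  horner_eval 'X_ord_max (map_poly (@mwiden n K) p).
Let E_onto n (q : {mpoly K[n.+1]}) : exists p, E p = q.
Proof.
have ED p1 p2 : E (p1 + p2) = E p1 + E p2 :> {mpoly K[n.+1]} by rewrite /E !rmorphD.
have EM p1 p2 : E (p1 * p2) = E p1 * E p2 :> {mpoly K[n.+1]} by rewrite /E !rmorphM.
have EX i : exists p, E p = 'X_i :> {mpoly K[n.+1]}.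
  have [j ->|->] := unliftP ord_max i; last first.
    by exists 'X; rewrite /E map_polyX horner_evalE hornerX.
  exists ('X_j)%:P; rewrite /E map_polyC horner_evalE hornerC /=.
  rewrite mwidenX; congr ('X_[_]).
  rewrite mnmwiden1; congr (U_(_))%MM; apply/val_inj => /=.
  by rewrite /bump leqNgt ltn_ord.
rewrite [q]mpolyE; apply: (big_ind (fun q => exists p, E p = q)) => [|_ _ [p <-] [p' <-]|m _].
- by exists 0; rewrite /E !rmorph0.
- by exists (p + p'); rewrite ED.
have [p Ep] : exists p, E p = 'X_[m] :> {mpoly K[n.+1]}.
  rewrite mpolyXE_id; apply: (big_ind (fun q => exists p, E p = q)) => [|_ _ [p <-] [p' <-]|i _].
  - by exists 1; rewrite /E !rmorph1.
  - by exists (p * p'); rewrite EM.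
  have [p Ep] := EX i.
  elim: (m i) => [|k [p' Ep']]; first by exists 1; rewrite /E !rmorph1.
  by exists (p * p'); rewrite EM Ep Ep' exprS.
exists ((q@_m)%:MP%:P * p).
by rewrite EM Ep {1}/E map_polyC horner_evalE hornerC /= mwidenC mul_mpolyC.
Qed.

Let ext n (v : 'I_n -> K) (xi : K) (i : 'I_n.+1) : K :=
  if unlift ord_max i is Some j then v j else xi.

Let E_eval n (p : {poly {mpoly K[n]}}) v xi :
  (E p).@[ext v xi] = (map_poly (meval v) p).[xi].
Proof.
rewrite /E horner_evalE -[X in X = _]horner_map /= mevalXU {2}/ext unlift_none.
congr (_.[_]); apply/polyP => k; rewrite !coef_map /=.
rewrite -[mwiden _]/(\sum_(m <- msupp p`_k)
  ((p`_k)@_m)%:MP * mmap1 (fun i => 'X_(widen i)) m).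
rewrite raddf_sum mevalE; apply: eq_bigr => m _.
rewrite /= mevalM mevalC; congr (_ * _).
rewrite /mmap1 rmorph_prod; apply: eq_bigr => i _.
rewrite rmorphXn /= mevalXU /ext.
have -> : widen i = lift ord_max i.
  by apply/val_inj => /=; rewrite /bump leqNgt ltn_ord.
by rewrite liftK.
Qed.

(* Hilbert's Nullstellensatz; s = 1 gives a common zero *)
Lemma prime_ideal_point n (P : {pred {mpoly K[n]}}) (s : {mpoly K[n]}) :
  idealr_closed P -> prime_idealr_closed P -> s \notin P ->
  exists v, (forall f, f \in P -> f.@[v] = 0) /\ s.@[v] != 0.
Proof.
elim: n => [|n IHn] in P s *.
  move=> idP prP sP; exists (fun=> 0).
  have cst (f : {mpoly K[0]}) : f.@[fun=> 0] = f@_0%MM.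
    by rewrite {1}[f]nvar0_mpolyC mevalC.
  split=> [f fP|]; rewrite cst; last first.
    apply: contraNneq sP => s0; rewrite [s]nvar0_mpolyC s0 mpolyC0.
    exact: ideal0.
  apply/eqP/negPn/negP => f0.
  have := idealM idP (f@_0%MM)^-1%:MP fP.
  by rewrite {2}[f]nvar0_mpolyC -mpolyCM mulVf // mpolyC1 (ideal1F idP).
move=> idP prP sP.
have ED p1 p2 : E (p1 + p2) = E p1 + E p2 :> {mpoly K[n.+1]} by rewrite /E !rmorphD.
have EM p1 p2 : E (p1 * p2) = E p1 * E p2 :> {mpoly K[n.+1]} by rewrite /E !rmorphM.
have E0 : E 0 = 0 :> {mpoly K[n.+1]} by rewrite /E !rmorph0.
have E1 : E 1 = 1 :> {mpoly K[n.+1]} by rewrite /E !rmorph1.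
pose P' : {pred {poly {mpoly K[n]}}} := fun p => E p \in P.
have P'E p : (p \in P') = (E p \in P) by [].
have idP' : idealr_closed P'.
  split; rewrite ?P'E ?E0 ?E1 ?(ideal0 idP) ?(ideal1F idP) //.
  move=> a u w; rewrite !P'E => uP wP.
  by rewrite ED EM; exact: (idealD idP (idealM idP _ uP) wP).
have prP' : prime_idealr_closed P' by move=> u w; rewrite !P'E EM; apply: prP.
have [s' Es'] := E_onto s.
have s'P' : s' \notin P' by rewrite P'E Es'.
have [r rP' Hr] := prime_extension K idP' prP' s'P'.
pose Q : {pred {mpoly K[n]}} := fun t => t%:P \in P'.
have QE t : (t \in Q) = (t%:P \in P') by [].
have idQ : idealr_closed Q.
  split; rewrite ?QE ?(ideal0 idP') ?(ideal1F idP') //.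
  move=> a u w; rewrite !QE => uP wP.
  by rewrite polyCD polyCM; exact: (idealD idP' (idealM idP' _ uP) wP).
have prQ : prime_idealr_closed Q.
  by move=> u w; rewrite !QE polyCM => /prP'.
have [v [vQ vr]] := IHn Q r idQ prQ rP'.
have [xi [xiP xis]] := Hr (meval v) vQ vr.
exists (ext v xi); split=> [f fP|]; last by rewrite -Es' E_eval.
have [p Ep] := E_onto f; rewrite -Ep E_eval; apply: xiP.
by rewrite P'E Ep.
Qed.

Lemma mpoly_nonroot n (f : {mpoly K[n]}) : f != 0 -> exists v, f.@[v] != 0.
Proof.
move=> f0; pose Z : {pred {mpoly K[n]}} := pred1 0.
have idZ : idealr_closed Z.
  split; rewrite ?inE ?oner_eq0 // => a u w; rewrite !inE => /eqP -> /eqP ->.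
  by rewrite mulr0 addr0.
have prZ : prime_idealr_closed Z by move=> u w; rewrite !inE mulf_eq0.
by have [v [_ fv]] := prime_ideal_point idZ prZ f0; exists v.
Qed.
End Nullstellensatz.

(* Matrices with blocks a b c d for which c is a cyclic vector of d are
   conjugate under GL(N) to their normal form. As normal_form is polynomial and
   GL(N)-invariant, composing with it retracts the polynomials on Mat(1 + N)
   onto the invariant ones (reynolds below), in any characteristic. *)
Section NormalForm.
Variables (R : comNzRingType) (N : nat).

Definition krylov_mx (d : 'M[R]_N) (c : 'cV[R]_N) : 'M[R]_N :=
  \matrix_(i, j) iter j (mulmx d) c i 0.

Definition frobenius_mx (d : 'M[R]_N) : 'M[R]_N :=
  \matrix_(i, j)
    if j.+1 == N then - (char_poly d)`_i else (i == j.+1 :> nat)%:R.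

Definition normal_form (g : 'M[R]_(1 + N)) : 'M[R]_(1 + N) :=
  block_mx (ulsubmx g) (ursubmx g *m krylov_mx (drsubmx g) (dlsubmx g))
           (\col_i (i == 0%N :> nat)%:R) (frobenius_mx (drsubmx g)).

Lemma normal_form_block a b c d : normal_form (block_mx a b c d) =
  block_mx a (b *m krylov_mx d c) (\col_i (i == 0%N :> nat)%:R)
           (frobenius_mx d).
Proof.
by rewrite /normal_form block_mxKul block_mxKur block_mxKdl block_mxKdr.
Qed.

Lemma char_poly_iter (d : 'M[R]_N) (c : 'cV[R]_N) :
  \sum_(k < N.+1) (char_poly d)`_k *: iter k (mulmx d) c = 0.
Proof.
case: N d c => [|n] d c; first by apply/matrixP; case.
have iterE k : iter k (mulmx d) c = d ^+ k *m c.
  elim: k => [|k IH]; first by rewrite expr0 mul1mx.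
  by rewrite iterS IH exprS mulmxA.
have := congr1 (mulmx^~ c) (Cayley_Hamilton d); rewrite /= mul0mx => CH.
rewrite -[RHS]CH -[in RHS](coefK (char_poly d)) poly_def raddf_sum /=.
rewrite mulmx_suml size_char_poly; apply: eq_bigr => k _.
by rewrite iterE linearZ /= rmorphXn /= horner_mx_X scalemxAl.
Qed.

Lemma mul_krylov_frobenius (d : 'M[R]_N) (c : 'cV[R]_N) :
  d *m krylov_mx d c = krylov_mx d c *m frobenius_mx d.
Proof.
apply/matrixP => i j; rewrite !mxE.
transitivity (iter j.+1 (mulmx d) c i 0).
  by rewrite iterS mxE; apply: eq_bigr => k _; rewrite !mxE.
have [jN|jN] := eqVneq j.+1 N; last first.
  have jN' : (j.+1 < N)%N by rewrite ltn_neqAle jN ltn_ord.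
  rewrite (bigD1 (Ordinal jN')) //= big1 => [|k kj]; rewrite !mxE (negbTE jN).
    by rewrite eqxx mulr1 addr0.
  by rewrite (_ : (k == j.+1 :> nat) = false) ?mulr0 //; apply: negbTE kj.
rewrite jN; have := congr1 (fun A : 'cV_N => A i 0) (char_poly_iter d c).
rewrite [in LHS]big_ord_recr [LHS]mxE [X in _ + X]mxE summxE [in RHS]mxE.
have -> : (char_poly d)`_N = 1.
  have /monicP := char_poly_monic d.
  by rewrite lead_coefE size_char_poly.
rewrite mul1r => /eqP; rewrite addrC addr_eq0 => /eqP ->.
rewrite -sumrN; apply: eq_bigr => k _.
by rewrite !mxE jN eqxx mulrN mulrC.
Qed.

Lemma krylov_e0 (d : 'M[R]_N) (c : 'cV[R]_N) :
  krylov_mx d c *m (\col_i (i == 0%N :> nat)%:R) = c.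
Proof.
apply/matrixP => i j; rewrite ord1 !mxE.
have N0 : (0 < N)%N by apply: leq_ltn_trans (ltn_ord i).
rewrite (bigD1 (Ordinal N0)) //= big1 => [|k k0]; rewrite !mxE /=.
  by rewrite mulr1 addr0.
by rewrite (_ : (k == 0%N :> nat) = false) ?mulr0 //; apply: negbTE k0.
Qed.

Lemma krylov_shift :
  krylov_mx (\matrix_(i, j) (i == j.+1 :> nat)%:R) (\col_i (i == 0%N :> nat)%:R)
  = 1%:M.
Proof.
have iterE k : (k < N)%N -> iter k (mulmx (\matrix_(i, j) (i == j.+1 :> nat)%:R))
    (\col_i (i == 0%N :> nat)%:R) = \col_(i < N) (i == k :> nat)%:R :> 'cV[R]_N.
  elim: k => [|k IH] kN //; rewrite iterS IH ?(ltnW kN) //.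
  apply/matrixP => i j; rewrite !mxE (bigD1 (Ordinal (ltnW kN))) //= big1.
    by rewrite !mxE eqxx mulr1 addr0.
  move=> l lk; rewrite !mxE (_ : (l == k :> nat) = false) ?mulr0 //.
  exact: negbTE lk.
by apply/matrixP => i j; rewrite mxE iterE // !mxE.
Qed.

End NormalForm.

Lemma map_krylov (R S : comNzRingType) (f : {rmorphism R -> S}) N
    (d : 'M[R]_N) (c : 'cV[R]_N) :
  map_mx f (krylov_mx d c) = krylov_mx (map_mx f d) (map_mx f c).
Proof.
apply/matrixP => i j; rewrite !mxE.
have -> : iter j (mulmx (map_mx f d)) (map_mx f c)
    = map_mx f (iter j (mulmx d) c).
  by elim: (val j) => //= k ->; rewrite map_mxM.
by rewrite mxE.
Qed.

Lemma map_normal_form (R S : comNzRingType) (f : {rmorphism R -> S}) N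
    (g : 'M[R]_(1 + N)) :
  map_mx f (normal_form g) = normal_form (map_mx f g).
Proof.
rewrite /normal_form map_block_mx map_ulsubmx map_mxM map_ursubmx map_krylov.
rewrite map_drsubmx map_dlsubmx; congr block_mx.
  by apply/matrixP => i j; rewrite !mxE rmorph_nat.
apply/matrixP => i j; rewrite !mxE -map_drsubmx -map_char_poly coef_map.
by case: ifP => _; rewrite ?rmorphN ?rmorph_nat.
Qed.

Section MaximalSpectrum.
Variable R : comNzRingType.

Definition maximal_ideal (m : {pred R}) : Prop :=
  idealr_closed m /\
  forall J : {pred R}, idealr_closed J -> {subset m <= J} -> {subset J <= m}.

Definition maxspec : Type := {m : R -> bool | `[< maximal_ideal m >]}.
HB.instance Definition _ := Choice.on maxspec.

Lemma maxspecP (x : maxspec) : maximal_ideal (val x).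
Proof. by apply/asboolP; case: x. Qed.

Lemma maxspec_eq (x y : maxspec) : {subset val x <= val y} -> x = y.
Proof.
move=> xy; apply/val_inj/funext => f.
have [_ xmax] := maxspecP x; have [yid _] := maxspecP y.
by apply/idP/idP; [apply: xy | apply: (xmax _ yid xy)].
Qed.

Lemma maximal_prime (m : {pred R}) : maximal_ideal m -> prime_idealr_closed m.
Proof.
move=> [idm maxm] u v uvm; have [//|um /=] := boolP (u \in m).
pose J : {pred R} := fun f => `[< exists a w, w \in m /\ f = a * u + w >].
have JP f : reflect (exists a w, w \in m /\ f = a * u + w) (f \in J).
  exact: asboolP.
have [J1|J1] := boolP (1 \in J).
  have [a [w [wm E]]] := JP 1 J1.
  rewrite -[v]mul1r E mulrDl -mulrA; apply: (idealD idm); first exact: idealM.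
  by rewrite mulrC; apply: idealM.
case/negP: um; apply: (maxm J).
- split=> //; first by apply/JP; exists 0, 0; rewrite (ideal0 idm) mul0r addr0.
  move=> a f g /JP[b [w [wm ->]]] /JP[b' [w' [w'm ->]]].
  apply/JP; exists (a * b + b'), (a * w + w'); split.
    by apply: (idealD idm) => //; apply: idealM.
  by rewrite mulrDr mulrDl addrACA mulrA.
- by move=> f fm; apply/JP; exists 0, f; rewrite mul0r add0r.
by apply/JP; exists 1, 0; rewrite (ideal0 idm) mul1r addr0.
Qed.
End MaximalSpectrum.

Section Colligations.
Variable K : closedFieldType.

(* polynomials in the entries of a matrix, ordered as in mxvec *)
Definition mx_poly N := {mpoly K[(1 + N) * (1 + N)]}.

Definition mx_eval N (g : 'M[K]_(1 + N)) (f : mx_poly N) : K :=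
  f.@[mxvec g 0].

Definition GL_act N (u : 'M[K]_N) (g : 'M[K]_(1 + N)) : 'M[K]_(1 + N) :=
  let w : 'M[K]_(1 + N) := block_mx 1%:M 0 0 u in w *m g *m invmx w.

(* K is infinite: f and its translate by u agree as polynomials as soon as
   they agree as functions *)
Definition invariant_poly N : {pred mx_poly N} := fun f =>
  `[< forall u : 'M[K]_N, u \in unitmx ->
      forall g, mx_eval (GL_act u g) f = mx_eval g f >].
Arguments invariant_poly N : clear implicits.

Lemma invariantP N (f : mx_poly N) :
  reflect (forall u : 'M[K]_N, u \in unitmx ->
           forall g, mx_eval (GL_act u g) f = mx_eval g f)
          (f \in invariant_poly N).
Proof. exact: asboolP. Qed.

Lemma invariant_subring N : subring_closed (invariant_poly N).
Proof.
split=> [|f h /invariantP fi /invariantP hi|f h /invariantP fi /invariantP hi];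
  apply/invariantP => u uu g; rewrite /mx_eval.
- by rewrite !rmorph1.
- by rewrite !rmorphB; congr (_ - _); [apply: fi | apply: hi].
- by rewrite !rmorphM; congr (_ * _); [apply: fi | apply: hi].
Qed.
HB.instance Definition _ N :=
  GRing.isSubringClosed.Build (mx_poly N) (invariant_poly N)
    (@invariant_subring N).

Record invariant_alg N :=
  InvariantAlg { inv_poly :> mx_poly N; _ : inv_poly \in invariant_poly N }.
HB.instance Definition _ N := [isSub of invariant_alg N for @inv_poly N].
HB.instance Definition _ N := [Choice of invariant_alg N by <:].
HB.instance Definition _ N :=
  [SubChoice_isSubComNzRing of invariant_alg N by <:].

(* the categorical quotient [Coll_N(1)]: closed points of the spectrum *)
Definition coll N : Type := maxspec (invariant_alg N).
HB.instance Definition _ N := Choice.on (coll N).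

(* the quotient map sends g to the ideal of the invariants vanishing at g; it
   is onto by coll_class_surj *)
Definition vanishing N (g : 'M[K]_(1 + N)) : invariant_alg N -> bool :=
  fun f => mx_eval g (val f) == 0.

Lemma vanishing_maximal N (g : 'M[K]_(1 + N)) :
  `[< maximal_ideal (vanishing g) >].
Proof.
have vE f : (f \in vanishing g) = (mx_eval g (val f) == 0) by [].
apply/asboolP; split.
  split; rewrite ?vE /mx_eval ?rmorph0 ?rmorph1 ?oner_eq0 //.
  move=> a u v; rewrite !vE => /eqP u0 /eqP v0.
  have -> : val (a * u + v) = val a * val u + val v by [].
  rewrite /mx_eval mevalD mevalM.
  by rewrite [X in _ * X]u0 [X in _ + X]v0 mulr0 addr0.
move=> J idJ mJ f fJ; rewrite vE; apply/negPn/negP => f0.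
have cst c : (c%:MP : mx_poly N) \in invariant_poly N.
  by apply/invariantP => u _ h; rewrite /mx_eval !mevalC.
pose c : invariant_alg N := InvariantAlg (cst (mx_eval g (val f))^-1).
have : 1 \in J.
  rewrite -[1](subrK (c * f)); apply: (idealD idJ); last exact: idealM.
  apply: mJ; rewrite vE.
  have -> : val (1 - c * f) = 1 - val c * val f by [].
  rewrite /mx_eval.
  by rewrite mevalB meval1 mevalM mevalC mulVf // subrr.
by rewrite (ideal1F idJ).
Qed.

Definition coll_class N (g : 'M[K]_(1 + N)) : coll N :=
  exist _ (vanishing g) (vanishing_maximal g).

Lemma in_coll_class N (g : 'M[K]_(1 + N)) f :
  (f \in val (coll_class g)) = (mx_eval g (val f) == 0).
Proof. by []. Qed.

Lemma coll_classP N (g h : 'M[K]_(1 + N)) :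
  coll_class g = coll_class h <->
  forall f, f \in invariant_poly N -> mx_eval g f = mx_eval h f.
Proof.
split=> [E f fi|E]; last first.
  apply: maxspec_eq => f; rewrite !in_coll_class => /eqP gf.
  by rewrite -E ?gf //; case: (f).
have cst c : (c%:MP : mx_poly N) \in invariant_poly N.
  by apply/invariantP => u _ k; rewrite /mx_eval !mevalC.
pose F : invariant_alg N := InvariantAlg fi - InvariantAlg (cst (mx_eval g f)).
have : F \in val (coll_class h).
  rewrite -E in_coll_class [val F]/(f - _) /mx_eval mevalB mevalC.
  by rewrite subrr.
rewrite in_coll_class [val F]/(f - _) /mx_eval mevalB mevalC subr_eq0.
by move=> /eqP.
Qed.

Lemma GL_actE N (u : 'M[K]_N) g : u \in unitmx ->
  GL_act u g = block_mx (ulsubmx g) (ursubmx g *m invmx u)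
    (u *m dlsubmx g) (u *m drsubmx g *m invmx u).
Proof.
move=> uu; rewrite /GL_act; set w := block_mx _ _ _ _.
have wV : w *m block_mx 1%:M 0 0 (invmx u) = 1%:M.
  rewrite mulmx_block !mul0mx !mulmx0 !mul1mx !addr0 add0r mulmxV //.
  by rewrite [RHS]scalar_mx_block.
have [wu _] := mulmx1_unit wV.
have -> : invmx w = block_mx 1%:M 0 0 (invmx u).
  by rewrite -[RHS](mulKmx wu) wV mulmx1.
rewrite -{1}[g]submxK /w !mulmx_block.
by rewrite !mul0mx !mulmx0 !mul1mx !mulmx1 ?addr0 ?add0r ?mul0mx ?addr0.
Qed.

Lemma coll_class_GL N (u : 'M[K]_N) g : u \in unitmx ->
  coll_class (GL_act u g) = coll_class g.
Proof. by move=> uu; apply/coll_classP => f /invariantP; apply. Qed.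

Lemma normal_form_GL N (u : 'M[K]_N) g : u \in unitmx ->
  normal_form (GL_act u g) = normal_form g.
Proof.
move=> uu; rewrite (GL_actE _ uu) normal_form_block [RHS]/normal_form.
have krE : krylov_mx (u *m drsubmx g *m invmx u) (u *m dlsubmx g) =
    u *m krylov_mx (drsubmx g) (dlsubmx g).
  have iterE k : iter k (mulmx (u *m drsubmx g *m invmx u)) (u *m dlsubmx g) =
      u *m iter k (mulmx (drsubmx g)) (dlsubmx g).
    by elim: k => //= k ->; rewrite -!mulmxA mulKmx.
  apply/matrixP => i j; rewrite mxE iterE !mxE.
  by apply: eq_bigr => k _; rewrite !mxE.
rewrite krE mulmxA (mulmxKV uu); congr block_mx.
have cpE : char_poly (u *m drsubmx g *m invmx u) = char_poly (drsubmx g).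
  have uP : map_mx polyC u \in unitmx by rewrite map_unitmx.
  rewrite /char_poly /char_poly_mx.
  have -> : 'X%:M - map_mx polyC (u *m drsubmx g *m invmx u) =
     map_mx polyC u *m ('X%:M - map_mx polyC (drsubmx g)) *m
     invmx (map_mx polyC u).
    rewrite mulmxBr mulmxBl !map_mxM map_invmx; congr (_ - _).
    by rewrite scalar_mxC mulmxK.
  by rewrite !det_mulmx det_inv mulrC mulKr // -unitmxE.
by apply/matrixP => i j; rewrite !mxE cpE.
Qed.

Lemma normal_form_krylov N (g : 'M[K]_(1 + N)) :
  let k := krylov_mx (drsubmx g) (dlsubmx g) in
  k \in unitmx -> normal_form g = GL_act (invmx k) g.
Proof.
move=> k ku; have ku1 : invmx k \in unitmx by rewrite unitmx_inv.
rewrite (GL_actE _ ku1) invmxK /normal_form -/k.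
congr block_mx; last by rewrite -mulmxA mul_krylov_frobenius (mulKmx ku).
by rewrite -[X in _ = _ *m X](krylov_e0 (drsubmx g)) (mulKmx ku).
Qed.

Definition generic_mx N : 'M[mx_poly N]_(1 + N) := vec_mx (\row_i 'X_i).

Lemma generic_mxE N (g : 'M[K]_(1 + N)) :
  map_mx (meval (mxvec g 0)) (generic_mx N) = g.
Proof.
rewrite map_vec_mx -[RHS]mxvecK; congr vec_mx.
by apply/rowP => i; rewrite !mxE mevalXU.
Qed.

Definition poly_subst N M (A : 'M[mx_poly N]_(1 + M)) (f : mx_poly M) :
    mx_poly N :=
  f \mPo [tuple mxvec A 0 i | i < (1 + M) * (1 + M)].

Lemma poly_substE N M (A : 'M[mx_poly N]_(1 + M)) f g :
  mx_eval g (poly_subst A f) = mx_eval (map_mx (meval (mxvec g 0)) A) f.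
Proof.
rewrite /mx_eval /poly_subst comp_mpoly_meval; apply: meval_eq => i.
by rewrite tnth_mktuple -map_mxvec mxE.
Qed.

Definition reynolds N (f : mx_poly N) : mx_poly N :=
  poly_subst (normal_form (generic_mx N)) f.

Lemma reynoldsE N (f : mx_poly N) g :
  mx_eval g (reynolds f) = mx_eval (normal_form g) f.
Proof. by rewrite /reynolds poly_substE map_normal_form generic_mxE. Qed.

Lemma reynolds_invariant N (f : mx_poly N) : reynolds f \in invariant_poly N.
Proof.
by apply/invariantP => u uu g; rewrite !reynoldsE normal_form_GL.
Qed.

Lemma reynolds_id N (f : mx_poly N) :
  f \in invariant_poly N -> reynolds f = f.
Proof.
move=> /invariantP fi; apply/eqP; rewrite -subr_eq0.
pose D : mx_poly N :=
  \det (krylov_mx (drsubmx (generic_mx N)) (dlsubmx (generic_mx N))).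
have DE g : mx_eval g D = \det (krylov_mx (drsubmx g) (dlsubmx g)).
  by rewrite /mx_eval -det_map_mx map_krylov map_drsubmx map_dlsubmx generic_mxE.
have D0 : D != 0.
  pose g : 'M[K]_(1 + N) := block_mx 0 0 (\col_i (i == 0%N :> nat)%:R)
     (\matrix_(i, j) (i == j.+1 :> nat)%:R).
  apply/eqP => D0; have := DE g; rewrite D0 block_mxKdr block_mxKdl.
  by rewrite krylov_shift det1 /mx_eval meval0 => /eqP; rewrite eq_sym oner_eq0.
have : D * (reynolds f - f) == 0.
  apply/negPn/negP => /mpoly_nonroot[v].
  pose g : 'M[K]_(1 + N) := vec_mx (\row_i v i).
  rewrite (@meval_eq _ _ v (mxvec g 0)) => [|i]; last by rewrite vec_mxK mxE.
  rewrite mevalM mulf_eq0 negb_or => /andP[].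
  rewrite -/(mx_eval g D) DE -unitfE -unitmxE => ku.
  rewrite mevalB -/(mx_eval g f) -/(mx_eval g (reynolds f)) reynoldsE.
  by rewrite normal_form_krylov // fi ?unitmx_inv // subrr eqxx.
by rewrite mulf_eq0 (negbTE D0).
Qed.

Lemma coll_class_surj N (x : coll N) : exists g, coll_class g = x.
Proof.
have maxx := maxspecP x; have [idx _] := maxx; have prx := maximal_prime maxx.
pose R (f : mx_poly N) := InvariantAlg (reynolds_invariant f).
have R0 : R 0 = 0 by apply: val_inj; rewrite /= /reynolds /poly_subst rmorph0.
have R1 : R 1 = 1 by apply: val_inj; rewrite /= /reynolds /poly_subst rmorph1.
have RD f h : R (f + h) = R f + R h.
  by apply: val_inj; rewrite /= /reynolds /poly_subst rmorphD.
have RM f h : R (f * h) = R f * R h.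
  by apply: val_inj; rewrite /= /reynolds /poly_subst rmorphM.
pose P : {pred mx_poly N} := fun f => R f \in val x.
have PE f : (f \in P) = (R f \in val x) by [].
have idP : idealr_closed P.
  split; rewrite ?PE ?R0 ?R1 ?(ideal0 idx) ?(ideal1F idx) //.
  move=> a u v; rewrite !PE RD RM => uP vP.
  exact: (idealD idx (idealM idx _ uP) vP).
have prP : prime_idealr_closed P by move=> u v; rewrite !PE RM => /prx.
have P1 : 1 \notin P by rewrite (ideal1F idP).
have [v [vP _]] := prime_ideal_point idP prP P1.
exists (vec_mx (\row_i v i)); apply/esym/maxspec_eq => f fx.
rewrite in_coll_class; apply/eqP.
have <- : meval v (val f) = mx_eval (vec_mx (\row_i v i)) (val f).
  by apply: meval_eq => i; rewrite vec_mxK mxE.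
apply: vP; rewrite PE.
suff -> : R (val f) = f by [].
by apply: val_inj; rewrite /= reynolds_id //; case: (f).
Qed.

End Colligations.

Definition mx_circ (R : nzRingType) N1 N2 (g : 'M[R]_(1 + N1))
    (h : 'M[R]_(1 + N2)) : 'M[R]_(1 + (N1 + N2)) :=
  let a := ulsubmx g in let b := ursubmx g in
  let c := dlsubmx g in let d := drsubmx g in
  let p := ulsubmx h in let q := ursubmx h in
  let r := dlsubmx h in let t := drsubmx h in
  block_mx (a *m p)          (row_mx b (a *m q))
           (col_mx (c *m p) r) (block_mx d (c *m q) 0 t).

Definition mx_stab (R : nzRingType) N (g : 'M[R]_(1 + N)) :
    'M[R]_(1 + (N + 1)) :=
  block_mx (ulsubmx g)            (row_mx (ursubmx g) 0)
           (col_mx (dlsubmx g) 0) (block_mx (drsubmx g) 0 0 1%:M).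

Lemma mx_circ_block (R : nzRingType) N1 N2
    (a p : 'M[R]_1) b c (d : 'M_N1) q r (t : 'M_N2) :
  mx_circ (block_mx a b c d) (block_mx p q r t) =
  block_mx (a *m p) (row_mx b (a *m q))
           (col_mx (c *m p) r) (block_mx d (c *m q) 0 t).
Proof.
rewrite /mx_circ (block_mxKul a) (block_mxKur a) (block_mxKdl a).
rewrite (block_mxKdr a) (block_mxKul p) (block_mxKur p) (block_mxKdl p).
by rewrite (block_mxKdr p).
Qed.

Lemma map_mx_circ (R S : nzRingType) (f : {rmorphism R -> S}) N1 N2
    (g : 'M[R]_(1 + N1)) (h : 'M[R]_(1 + N2)) :
  map_mx f (mx_circ g h) = mx_circ (map_mx f g) (map_mx f h).
Proof.
rewrite /mx_circ map_block_mx map_row_mx map_col_mx map_block_mx !map_mxM.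
by rewrite map_mx0 !map_ulsubmx !map_ursubmx !map_dlsubmx !map_drsubmx.
Qed.

Lemma mx_stabE (R : nzRingType) N (g : 'M[R]_(1 + N)) :
  mx_stab g = mx_circ g (1%:M : 'M_(1 + 1)).
Proof.
rewrite -[g in RHS]submxK scalar_mx_block mx_circ_block /mx_stab.
by rewrite !mulmx1 !mulmx0.
Qed.

Lemma mx_circA (R : nzRingType) N1 N2 N3 (g : 'M[R]_(1 + N1))
    (h : 'M[R]_(1 + N2)) (k : 'M[R]_(1 + N3))
    (e := congr1 (addn 1) (addnA N1 N2 N3)) :
  castmx (e, e) (mx_circ g (mx_circ h k)) = mx_circ (mx_circ g h) k.
Proof.
rewrite -[g]submxK -[h]submxK -[k]submxK !mx_circ_block.
rewrite !mul_mx_row !mul_col_mx !mulmxA.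
move: (ulsubmx g *m ulsubmx h *m ulsubmx k) => A1.
move: (ursubmx g) (dlsubmx g) (drsubmx g) => b c d.
apply/matrixP => i j; rewrite castmxE.
rewrite /=; set e1 := esym e.
have cE (l : 'I_(1 + (N1 + (N2 + N3)))) (l' : 'I_(1 + (N1 + N2 + N3))) :
  val l' = val l -> cast_ord e1 l' = l by move=> ll'; apply/val_inj.
have c0 (l : 'I_1) : cast_ord e1 (lshift _ l) = lshift _ l by exact: cE.
have c1 (l : 'I_N1) : cast_ord e1 (rshift 1 (lshift N3 (lshift N2 l)))
    = rshift 1 (lshift (N2 + N3) l) by exact: cE.
have c2 (l : 'I_N2) : cast_ord e1 (rshift 1 (lshift N3 (rshift N1 l)))
    = rshift 1 (rshift N1 (lshift N3 l)) by exact: cE.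
have c3 (l : 'I_N3) : cast_ord e1 (rshift 1 (rshift (N1 + N2) l))
    = rshift 1 (rshift N1 (rshift N2 l)) by apply: cE; rewrite /= -!addnA.
case: (split_ordP i) => {}i ->; last first;
  [case: (split_ordP i) => {}i ->; first case: (split_ordP i) => {}i -> |].
all: case: (split_ordP j) => {}j ->; last first;
  [case: (split_ordP j) => {}j ->; first case: (split_ordP j) => {}j -> |].
all: rewrite ?c0 ?c1 ?c2 ?c3.
all: rewrite ?(block_mxEul, block_mxEur, block_mxEdl, block_mxEdr) ?(row_mxEl,
  row_mxEr, col_mxEu, col_mxEd) ?(block_mxEul, block_mxEur, block_mxEdl,
  block_mxEdr).
all: by rewrite ?(row_mxEl, row_mxEr, col_mxEu, col_mxEd) ?mxE.
Qed.

Section Operations.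
Variable K : closedFieldType.
Local Notation coll := (coll K).

Lemma GL_act_block N (u v : 'M[K]_N) a b c d : u *m v = 1%:M ->
  GL_act u (block_mx a b c d) = block_mx a (b *m v) (u *m c) (u *m d *m v).
Proof.
move=> uv; have [uu _] := mulmx1_unit uv.
have <- : invmx u = v by rewrite -[v](mulKmx uu) uv mulmx1.
by rewrite (GL_actE _ uu) block_mxKul block_mxKur block_mxKdl block_mxKdr.
Qed.

Lemma coll_class_block N N' (e : N = N') (u : 'M[K]_(N', N))
    (v : 'M[K]_(N, N')) a b c d : u *m v = 1%:M -> v *m u = 1%:M ->
  Tagged coll (coll_class (block_mx a b c d : 'M_(1 + N))) =
  Tagged coll (coll_class
    (block_mx a (b *m v) (u *m c) (u *m d *m v) : 'M_(1 + N'))).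
Proof.
case: N' / e u v => u v uv vu; congr existT.
have [uu _] := mulmx1_unit uv.
by rewrite -(coll_class_GL _ uu) (GL_act_block _ _ _ _ uv).
Qed.

Lemma coll_class_cast N N' (e : N = N') (g : 'M[K]_(1 + N))
    (e' := congr1 (addn 1) e) :
  Tagged coll (coll_class g) = Tagged coll (coll_class (castmx (e', e') g)).
Proof.
by rewrite /e'; case: N' / e {e'}; congr existT.
Qed.

Lemma mx_circ_class N1 N2 (g g' : 'M[K]_(1 + N1)) (h h' : 'M[K]_(1 + N2)) :
  coll_class g = coll_class g' -> coll_class h = coll_class h' ->
  coll_class (mx_circ g h) = coll_class (mx_circ g' h').
Proof.
move=> /coll_classP gg' /coll_classP hh'; apply/coll_classP => f /invariantP fi.
have cstE M N (x : 'M[K]_(1 + M)) (y : 'M[K]_(1 + N)) :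
    map_mx (meval (mxvec x 0)) (map_mx (@mpolyC _ K) y) = y.
  by apply/matrixP => i j; rewrite !mxE mevalC.
have actl u x y : u \in unitmx -> exists2 w, w \in unitmx &
    mx_circ (GL_act u x) y = GL_act w (mx_circ x y) :> 'M[K]_(1 + (N1 + N2)).
  move=> uu; have wv : block_mx u 0 0 (1%:M : 'M_N2) *m
      block_mx (invmx u) 0 0 1%:M = 1%:M.
    rewrite mulmx_block !mul0mx !mulmx0 !mul1mx !(add0r, addr0) mulmxV //.
    by rewrite -scalar_mx_block.
  have [wu _] := mulmx1_unit wv; exists (block_mx u 0 0 1%:M) => //.
  rewrite (GL_actE _ uu) -[in RHS](submxK x) -{1}(submxK y).
  rewrite -[in RHS](submxK y) !mx_circ_block (GL_act_block _ _ _ _ wv).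
  rewrite mul_row_block mul_block_col !mulmx_block.
  by rewrite !mul0mx !mulmx0 !mul1mx !mulmx1 !(add0r, addr0) !mulmxA ?mul0mx.
have actr u x y : u \in unitmx -> exists2 w, w \in unitmx &
    mx_circ x (GL_act u y) = GL_act w (mx_circ x y) :> 'M[K]_(1 + (N1 + N2)).
  move=> uu; have wv : block_mx (1%:M : 'M_N1) 0 0 u *m
      block_mx 1%:M 0 0 (invmx u) = 1%:M.
    rewrite mulmx_block !mul0mx !mulmx0 !mul1mx !(add0r, addr0) mulmxV //.
    by rewrite -scalar_mx_block.
  have [wu _] := mulmx1_unit wv; exists (block_mx 1%:M 0 0 u) => //.
  rewrite (GL_actE _ uu) -[in RHS](submxK y) -{1}(submxK x).
  rewrite -[in RHS](submxK x) !mx_circ_block (GL_act_block _ _ _ _ wv).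
  rewrite mul_row_block mul_block_col !mulmx_block.
  by rewrite !mul0mx !mulmx0 !mul1mx !mulmx1 !(add0r, addr0) !mulmxA ?mul0mx ?mulmx0.
transitivity (mx_eval (mx_circ g' h) f).
  pose A := mx_circ (generic_mx K N1) (map_mx (@mpolyC _ K) h).
  have AE x : mx_eval x (poly_subst A f) = mx_eval (mx_circ x h) f.
    by rewrite poly_substE map_mx_circ generic_mxE cstE.
  rewrite -!AE; apply: gg'; apply/invariantP => u uu x; rewrite !AE.
  by have [w wu ->] := actl u x h uu; apply: fi.
pose A := mx_circ (map_mx (@mpolyC _ K) g') (generic_mx K N2).
have AE x : mx_eval x (poly_subst A f) = mx_eval (mx_circ g' x) f.
  by rewrite poly_substE map_mx_circ generic_mxE cstE.
rewrite -!AE; apply: hh'; apply/invariantP => u uu x; rewrite !AE.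
by have [w wu ->] := actr u g' x uu; apply: fi.
Qed.

(* The operations induced on the quotients are computed on arbitrary lifts;
   coll_circE and coll_stabE show that the lifts do not matter. *)
Definition coll_rep N (x : coll N) : 'M[K]_(1 + N) :=
  sval (cid (coll_class_surj x)).

Lemma coll_repK N (x : coll N) : coll_class (coll_rep x) = x.
Proof. exact: svalP (cid (coll_class_surj x)). Qed.

Definition coll_circ N1 N2 (x : coll N1) (y : coll N2) : coll (N1 + N2) :=
  coll_class (mx_circ (coll_rep x) (coll_rep y)).

Definition coll_stab N (x : coll N) : coll (N + 1) :=
  coll_class (mx_stab (coll_rep x)).

Lemma coll_circE N1 N2 (g : 'M[K]_(1 + N1)) (h : 'M[K]_(1 + N2)) :
  coll_circ (coll_class g) (coll_class h) = coll_class (mx_circ g h).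
Proof. by apply: mx_circ_class; rewrite coll_repK. Qed.

Lemma coll_stabE N (g : 'M[K]_(1 + N)) :
  coll_stab (coll_class g) = coll_class (mx_stab g).
Proof.
by rewrite /coll_stab !mx_stabE; apply: mx_circ_class; rewrite ?coll_repK.
Qed.

(* [Coll_oo(1)] is the colimit of the maps coll_stab: the quotient of the
   disjoint union of the [Coll_N(1)] by the equivalence relation generated by
   x ~ coll_stab x *)
Inductive coll_equiv : {N & coll N} -> {N & coll N} -> Prop :=
| coll_equiv_stab N (x : coll N) :
    coll_equiv (Tagged coll x) (Tagged coll (coll_stab x))
| coll_equiv_refl x : coll_equiv x x
| coll_equiv_sym x y : coll_equiv x y -> coll_equiv y x
| coll_equiv_trans y x z : coll_equiv x y -> coll_equiv y z -> coll_equiv x z.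

Definition coll_equivb : rel {N & coll N} := fun x y => `[< coll_equiv x y >].

Lemma coll_equivb_refl : reflexive coll_equivb.
Proof. by move=> x; apply/asboolP/coll_equiv_refl. Qed.
Lemma coll_equivb_sym : ssrbool.symmetric coll_equivb.
Proof.
by move=> x y; apply/asboolP/asboolP; apply: coll_equiv_sym.
Qed.
Lemma coll_equivb_trans : transitive coll_equivb.
Proof.
move=> y x z /asboolP xy /asboolP yz; apply/asboolP.
exact: coll_equiv_trans xy yz.
Qed.

Canonical coll_equiv_rel :=
  EquivRel coll_equivb coll_equivb_refl coll_equivb_sym coll_equivb_trans.

Definition coll_inf : Type := {eq_quot coll_equiv_rel}%qT.
HB.instance Definition _ := Choice.on coll_inf.

Definition tcirc (x y : {N & coll N}) : {N & coll N} :=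
  Tagged coll (coll_circ (tagged x) (tagged y)).

Let one : {N & coll N} := Tagged coll (coll_class (1%:M : 'M[K]_(1 + 1))).

Lemma tcircA : associative tcirc.
Proof.
move=> [N1 x] [N2 y] [N3 z]; rewrite /tcirc /=.
rewrite -(coll_repK x) -(coll_repK y) -(coll_repK z) !coll_circE.
by rewrite (coll_class_cast (addnA N1 N2 N3)) mx_circA.
Qed.

Lemma tcirc_stab N (x : coll N) :
  Tagged coll (coll_stab x) = tcirc (Tagged coll x) one.
Proof.
rewrite /tcirc /one /= -(coll_repK x) coll_stabE.
by rewrite [in RHS]coll_circE mx_stabE.
Qed.

Lemma tcirc1C x : tcirc one x = tcirc x one.
Proof.
case: x => N x; rewrite /tcirc /one /= -(coll_repK x) !coll_circE.
move: (coll_rep x) => {x} g; rewrite -[g]submxK scalar_mx_block !mx_circ_block.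
rewrite !mul0mx !mul1mx !mulmx1 !mulmx0.
pose u : 'M[K]_(N + 1, 1 + N) := block_mx 0 1%:M 1%:M 0.
pose v : 'M[K]_(1 + N, N + 1) := block_mx 0 1%:M 1%:M 0.
have Eb (b : 'rV[K]_N) : row_mx (0 : 'M_1) b *m v = row_mx b 0.
  by rewrite mul_row_block !mul0mx !mulmx0 !mulmx1 add0r addr0.
have Ec (c : 'cV[K]_N) : u *m col_mx (0 : 'M_1) c = col_mx c 0.
  by rewrite mul_block_col !mul0mx !mulmx0 !mul1mx add0r addr0.
have Ed (d : 'M[K]_N) :
    u *m block_mx (1%:M : 'M_1) 0 0 d *m v = block_mx d 0 0 1%:M.
  rewrite !mulmx_block !mul0mx !mulmx0 !mul1mx !mulmx1.
  by rewrite !(add0r, addr0).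
have uv : u *m v = 1%:M.
  rewrite mulmx_block !mul0mx !mulmx0 !mul1mx !(add0r, addr0).
  by rewrite -scalar_mx_block.
have vu : v *m u = 1%:M.
  rewrite mulmx_block !mul0mx !mulmx0 !mul1mx !(add0r, addr0).
  by rewrite -scalar_mx_block.
by rewrite (coll_class_block (addnC 1%N N) _ _ _ _ uv vu) Eb Ec Ed.
Qed.

Lemma tcirc_equivl x x' y :
  coll_equiv x x' -> coll_equiv (tcirc x y) (tcirc x' y).
Proof.
elim=> {x x'} [N x|x|x x' _ IH|x' x x'' _ IH1 _ IH2].
- rewrite tcirc_stab -tcircA tcirc1C tcircA.
  by case: (tcirc _ _) => M z; rewrite -tcirc_stab; apply: coll_equiv_stab.
- exact: coll_equiv_refl.
- exact: coll_equiv_sym.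
exact: coll_equiv_trans IH1 IH2.
Qed.

Lemma tcirc_equivr x y y' :
  coll_equiv y y' -> coll_equiv (tcirc x y) (tcirc x y').
Proof.
elim=> {y y'} [N y|y|y y' _ IH|y' y y'' _ IH1 _ IH2].
- rewrite tcirc_stab tcircA.
  by case: (tcirc _ _) => M z; rewrite -tcirc_stab; apply: coll_equiv_stab.
- exact: coll_equiv_refl.
- exact: coll_equiv_sym.
exact: coll_equiv_trans IH1 IH2.
Qed.

Definition coll_inf_class N (x : coll N) : coll_inf :=
  \pi_({eq_quot coll_equiv_rel})%qT (Tagged coll x).

Definition coll_inf_circ (x y : coll_inf) : coll_inf :=
  let x' := repr (x : {eq_quot coll_equiv_rel}%qT) in
  let y' := repr (y : {eq_quot coll_equiv_rel}%qT) in
  coll_inf_class (coll_circ (tagged x') (tagged y')).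

Lemma coll_inf_classP N M (x : coll N) (y : coll M) :
  coll_inf_class x = coll_inf_class y <->
  coll_equiv (Tagged coll x) (Tagged coll y).
Proof.
split=> [/eqmodP/asboolP //|xy].
by apply/eqmodP/asboolP.
Qed.

Lemma coll_inf_circE N M (x : coll N) (y : coll M) :
  coll_inf_circ (coll_inf_class x) (coll_inf_class y) =
  coll_inf_class (coll_circ x y).
Proof.
have reprE L (z : coll L) : coll_equiv
    (repr (coll_inf_class z : {eq_quot coll_equiv_rel}%qT)) (Tagged coll z).
  suff /asboolP : coll_equiv_rel (repr (coll_inf_class z
    : {eq_quot coll_equiv_rel}%qT)) (Tagged coll z) by [].
  by apply/(eqmodP coll_equiv_rel); rewrite reprK.
apply/eqmodP/asboolP; apply: coll_equiv_trans (tcirc_equivl _ (reprE N x)) _.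
exact: tcirc_equivr (reprE M y).
Qed.

Lemma coll_inf_surj (z : coll_inf) :
  exists N (x : coll N), z = coll_inf_class x.
Proof.
elim/quotW: z => -[N x]; by exists N, x.
Qed.

Lemma coll_inf_circA : associative coll_inf_circ.
Proof.
move=> x y z; have [N1 [{}x ->]] := coll_inf_surj x.
have [N2 [{}y ->]] := coll_inf_surj y; have [N3 [{}z ->]] := coll_inf_surj z.
rewrite !coll_inf_circE.
have := tcircA (Tagged coll x) (Tagged coll y) (Tagged coll z).
by rewrite /tcirc /= /coll_inf_class => ->.
Qed.

HB.instance Definition _ := isSemigroup.Build coll_inf coll_inf_circA.

End Operations.

(* Main.v *)
(** An invariant polynomial takes the same value at g and at its normal form,
    so the class of a colligation [[a, b], [c, d]] depends only on a, on the
    moments b d^k c and on the characteristic polynomial of d. In other words it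
    is determined by det(z - d) and the transfer function a + b (z - d)^-1 c;
    both are multiplicative for the circle product, hence insensitive to the
    order of the factors. *)
Require Import Defs.
From mathcomp Require Import all_boot all_order all_algebra all_fingroup.
Set Implicit Arguments. Unset Strict Implicit. Unset Printing Implicit Defensive.
Import GRing.Theory.
Local Open Scope ring_scope.

Lemma mx11_mulC (R : comNzRingType) (A B : 'M[R]_1) : A *m B = B *m A.
Proof. by rewrite [A]mx11_scalar scalar_mxC. Qed.

Lemma char_poly_ublock (R : comNzRingType) m n
    (A : 'M[R]_m) (B : 'M_(m, n)) (C : 'M_n) :
  char_poly (block_mx A B 0 C) = char_poly A * char_poly C.
Proof.
rewrite /char_poly /char_poly_mx map_block_mx map_mx0 (scalar_mx_block m n).
by rewrite opp_block_mx add_block_mx oppr0 addr0 det_ublock.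
Qed.

Section Moments.
Variable R : comNzRingType.

Definition moment n (b : 'rV[R]_n) (d : 'M_n) (c : 'cV_n) k : 'M_1 :=
  b *m iter k (mulmx d) c.

Lemma iter_mul_ublock m n l (d : 'M[R]_m) (s : 'M_(m, n)) (t : 'M_n)
    (c : 'M_(m, l)) (r : 'M_(n, l)) k :
  iter k (mulmx (block_mx d s 0 t)) (col_mx c r) =
  col_mx (iter k (mulmx d) c
          + \sum_(i < k) iter i (mulmx d) (s *m iter (k - i.+1) (mulmx t) r))
         (iter k (mulmx t) r).
Proof.
elim: k => [|k IH] /=; first by rewrite big_ord0 addr0.
rewrite IH mul_block_col mul0mx add0r big_ord_recl /= subn1 /= mulmxDr.
rewrite -addrA; congr (col_mx (_ + _) _); rewrite addrC mulmx_sumr.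
by congr (_ + _); apply: eq_bigr => i _; rewrite /= subSS.
Qed.

Lemma iter_mulmxr n m p (d : 'M[R]_n) (c : 'M_(n, m)) (A : 'M_(m, p)) k :
  iter k (mulmx d) (c *m A) = iter k (mulmx d) c *m A.
Proof. by elim: k => //= k ->; rewrite mulmxA. Qed.

(** The coupling [c *m q] factors through dimension 1, so each crossing term splits into two
    moments: this is the Cauchy product of the transfer functions. *)
Lemma moment_circ m n (a p : 'M[R]_1) b c (d : 'M_m) q r (t : 'M_n) k :
  moment (row_mx b (a *m q)) (block_mx d (c *m q) 0 t) (col_mx (c *m p) r) k =
  moment b d c k *m p + a *m moment q t r k
  + \sum_(i < k) moment b d c i *m moment q t r (k - i.+1).
Proof.
rewrite /moment iter_mul_ublock mul_row_col iter_mulmxr mulmxDr !mulmxA.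
rewrite mulmx_sumr addrAC; congr (_ + _); apply: eq_bigr => i _.
by rewrite -[c *m q *m _]mulmxA iter_mulmxr !mulmxA.
Qed.

Lemma moment_circC m n (a p : 'M[R]_1) b c (d : 'M_m) q r (t : 'M_n) k :
  moment (row_mx b (a *m q)) (block_mx d (c *m q) 0 t) (col_mx (c *m p) r) k =
  moment (row_mx q (p *m b)) (block_mx t (r *m b) 0 d) (col_mx (r *m a) c) k.
Proof.
rewrite !moment_circ addrC [RHS]addrC; congr (_ + _); last first.
  by rewrite addrC (mx11_mulC a) (mx11_mulC p).
(* Reversal [i -> k - 1 - i] swaps the two indices of the convolution. *)
rewrite (reindex_inj rev_ord_inj); apply: eq_bigr => i _.
by rewrite mx11_mulC -[(k - (rev_ord i).+1)%N]/(val (rev_ord (rev_ord i))) rev_ordK.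
Qed.

End Moments.

Section Classes.
Variable K : closedFieldType.

(** An invariant equals its [reynolds] image as a polynomial, so this holds even where the Krylov
    matrix of [g] is singular. *)
Lemma coll_class_normal_form N (g : 'M[K]_(1 + N)) :
  coll_class (normal_form g) = coll_class g.
Proof.
by apply/coll_classP => f fi; rewrite -[in RHS](reynolds_id fi) reynoldsE.
Qed.

Lemma krylov_moment N (b : 'rV[K]_N) (d : 'M_N) c :
  b *m krylov_mx d c = \row_k moment b d c k 0 0.
Proof. by apply/rowP => k; rewrite !mxE; apply: eq_bigr => i _; rewrite mxE. Qed.

(** Both sides have the same normal form. [Tagged] allows sizes that are only provably equal, such
    as [N + M] and [M + N]. *)
Lemma coll_class_moments N N' a (b : 'rV[K]_N) c d (b' : 'rV[K]_N') c' d' :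
    N = N' -> moment b d c =1 moment b' d' c' -> char_poly d = char_poly d' ->
  Tagged (coll K) (coll_class (block_mx a b c d)) =
  Tagged (coll K) (coll_class (block_mx a b' c' d')).
Proof.
move=> eN; case: N' / eN b' c' d' => b' c' d' eqm eqd; congr existT.
suff nfE : normal_form (block_mx a b c d) = normal_form (block_mx a b' c' d').
  by rewrite -coll_class_normal_form nfE coll_class_normal_form.
rewrite !normal_form_block; congr block_mx; last first.
  by apply: eq_mx => i j; rewrite eqd.
by rewrite krylov_moment [RHS]krylov_moment; apply: eq_mx => i k; rewrite eqm.
Qed.

(** Commutativity holds already at finite level, before passing to the limit. *)
Lemma tcircC (x y : {N & coll K N}) : tcirc x y = tcirc y x.
Proof.
case: x y => [N x] [M y]; rewrite /tcirc /= -(coll_repK x) -(coll_repK y).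
rewrite !coll_circE; move: (coll_rep x) (coll_rep y) => {x y} g h.
rewrite -[g]submxK -[h]submxK !mx_circ_block (mx11_mulC (ulsubmx h)).
apply: coll_class_moments; first exact: addnC.
  by move=> k; apply: moment_circC.
by rewrite !char_poly_ublock mulrC.
Qed.

End Classes.

Theorem theorem3p1 (K : closedFieldType) (x y : coll_inf K) :
  (x * y = y * x)%g.
Proof.
have [N [{}x ->]] := coll_inf_surj x; have [M [{}y ->]] := coll_inf_surj y.
rewrite [LHS]coll_inf_circE [RHS]coll_inf_circE.
exact: congr1 (tcircC (Tagged (coll K) x) (Tagged (coll K) y)).
Qed.
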